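(* Let $n\ge 1$ and let $\mathfrak g$ be an affine Kac-Moody algebra of type $A_n^{(1)}$ with minimal positive imaginary root $\delta$. Then $$\prod_{i=1}^n \prod_{j=1}^\infty \frac{1-q^{-i}\boldsymbol z^{j\delta}}{1-q^{-(i+1)}\boldsymbol z^{j\delta}} = \sum_{Y\in \mathcal Y_0} (1-q)^{\mathscr N(Y)} q^{-\mathscr M(Y)}\boldsymbol z^{|Y|\delta},$$ where $\mathcal Y_0$ is the set of reduced proper generalized Young walls whose rows in positions $\equiv 0 \bmod (n+1)$ are all empty, and $\mathscr N(Y),\mathscr M(Y),|Y|$ are as defined in the context.
   Context: $I=\{0,1,\dots,n\}$, $\alpha_i$ ($i\in I$) are the simple roots, $\delta=\alpha_0+\cdots+\alpha_n$; $\boldsymbol z^{\alpha}$ are formal exponentials and the identity is one of formal power series in $\boldsymbol z^{\delta}$. **Generalized Young walls.** The board has rows numbered $1,2,3,\dots$ from bottom to top and columns numbered $1,2,3,\dots$ from right to left; the site in row $j$ and column $i$ has color $j-i \bmod (n+1)$, an element of $I$. A generalized Young wall is a finite collection of boxes placed on sites of the board, each colored by the color of its site, such that in each row the boxes are stacked from right to left without gaps. $N_k(Y)$ is the number of boxes in the $k$th row of $Y$. $Y$ is proper if $N_k(Y)\le N_\ell(Y)$ whenever $k>\ell$ and $k\equiv\ell \bmod (n+1)$. Let $a_i(k)$ be the number of $i$-colored boxes in the $k$th column $Y_k$. The column $Y_k$ contains a removable $\delta$ if one may remove one $i$-colored box for every $i\in I$ from $Y_k$ and still obtain a generalized Young wall,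 i.e. if $a_{i-1}(k+1)<a_i(k)$ for all $i\in I$ (indices mod $n+1$). $Y$ is reduced if no column contains a removable $\delta$. $\mathcal Y(\infty)$ is the set of all reduced proper generalized Young walls, and $\mathcal Y_0\subset\mathcal Y(\infty)$ is the subset of those with empty rows in all positions $\equiv 0\bmod (n+1)$. **Statistics.** For $Y\in\mathcal Y(\infty)$ and $1\le j\le n+1$ let $S_j(Y)=\bigcup_{m\ge0}\{N_{(n+1)m+j}(Y)\}$ (a set of distinct values). For $m\ge0$ write $N_{(n+1)(m+1)}(Y)=(n+1)^{p_m}q_m$ with $p_m\ge 0$ and $q_m$ not divisible by $n+1$; if $N_{(n+1)(m+1)}(Y)=0$ put $(p_m,q_m)=(0,0)$. Set $$\mathscr Q(Y)=\Big(\bigcup_{m\ge0}\{(n+1)^sq_m:s=0,1,\dots,p_m-1\}\Big)\cup\{0\},\qquad \mathscr P(Y)=\sum_{t\ge1,\ (n+1)\nmid t}\max\{p_m:q_m=t,\ m\ge0\},$$ where the maximum of the empty set is $0$, and $$\mathscr N(Y)=n\,\mathscr P(Y)+\sum_{j=1}^{n+1}\#\big(S_j(Y)\setminus\mathscr Q(Y)\big).$$ For $Y\in\mathcal Y_0$, $\mathscr M(Y)=\sum_{i=1}^n(i+1)M_i(Y)$, where $M_i(Y)$ is the number of nonempty rows of $Y$ in positions $\equiv i\bmod (n+1)$, and $|Y|$ is the total number of boxes in $Y$. *)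

(* Defs.v *)
From HB Require Import structures.
From mathcomp Require Import all_boot all_order all_algebra.
From mathcomp Require Import finmap.
From mathcomp Require Import boolp classical_sets functions cardinality fsbigop.
From mathcomp Require Import mpoly.

Set Implicit Arguments.
Unset Strict Implicit.
Unset Printing Implicit Defensive.

Import GRing.Theory.

Local Open Scope ring_scope.

(* ------------------------------------------------------------------------ *)
(* Formal power series in the formal exponentials of k simple roots: the     *)
(* series f has coefficient f m at z^m, where the monomial m : 'X_{1..k}     *)
(* stands for the element \sum_i m i * alpha_i of the positive root cone.    *)
(* ------------------------------------------------------------------------ *)

Definition fseries (k : nat) (R : Type) : Type := 'X_{1..k} -> R.

HB.instance Definition _ (k : nat) (R : comUnitRingType) :=
  GRing.Lmodule.copy (fseries k R) ('X_{1..k} -> R^o).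

Section SeriesRing.
Context {k : nat} {R : comUnitRingType}.
Implicit Types (f g h : fseries k R) (m : 'X_{1..k}).

Definition zexp (a : 'X_{1..k}) : fseries k R := fun m => (m == a)%:R.

Definition fseries_mul f g : fseries k R := fun m =>
  \sum_(p : 'X_{1..k < (mdeg m).+1, (mdeg m).+1} | m == (p.1 + p.2)%MM)
     f p.1 * g p.2.

Definition ftrunc (d : nat) f : {mpoly R[k]} :=
  \sum_(m : 'X_{1..k < d}) f m *: 'X_[m].

Lemma coef_ftrunc d f m : (mdeg m < d)%N -> (ftrunc d f)@_m = f m.
Proof.
move=> md; rewrite /ftrunc raddf_sum /= (bigD1 (BMultinom md)) //=.
rewrite mcoeffZ mcoeffX eqxx mulr1 big1 ?addr0 // => m' nm.
rewrite mcoeffZ mcoeffX; case: eqVneq => [e|]; rewrite ?mulr0 //.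
by case/negP: nm; rewrite bmeqP /= e.
Qed.

Lemma fseries_mulE d f g m : (mdeg m < d)%N ->
  fseries_mul f g m = (ftrunc d f * ftrunc d g)@_m.
Proof.
move=> md; rewrite mcoeffM; apply: eq_bigr => p _.
by rewrite !coef_ftrunc // (leq_trans (bmdeg _) md).
Qed.

Lemma eq_mcoeffM (d : nat) (p1 p2 q1 q2 : {mpoly R[k]}) :
  (forall m, (mdeg m < d)%N -> p1@_m = p2@_m) ->
  (forall m, (mdeg m < d)%N -> q1@_m = q2@_m) ->
  forall m, (mdeg m < d)%N -> (p1 * q1)@_m = (p2 * q2)@_m.
Proof.
move=> e1 e2 m md; rewrite !mcoeffM; apply: eq_bigr => p _.
by rewrite e1 ?e2 // (leq_trans (bmdeg _) md).
Qed.

Lemma fseries_mulA : associative fseries_mul.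
Proof.
move=> f g h; apply/funext => m; pose d := (mdeg m).+1.
rewrite !(@fseries_mulE d) //.
transitivity ((ftrunc d f * (ftrunc d g * ftrunc d h))@_m).
  apply: (@eq_mcoeffM d) => // m' md.
  by rewrite coef_ftrunc // (@fseries_mulE d).
rewrite mulrA; apply: (@eq_mcoeffM d) => // m' md.
by rewrite coef_ftrunc // (@fseries_mulE d).
Qed.

Lemma fseries_mulC : commutative fseries_mul.
Proof.
move=> f g; apply/funext => m.
by rewrite !(@fseries_mulE (mdeg m).+1) // mulrC.
Qed.

Lemma fseries_mul1 : left_id (zexp 0%MM) fseries_mul.
Proof.
move=> f; apply/funext => m; pose d := (mdeg m).+1.
rewrite (@fseries_mulE d) // -[RHS](@coef_ftrunc d) // -[in RHS](mul1r (ftrunc d f)).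
apply: (@eq_mcoeffM d) => // m' md.
by rewrite coef_ftrunc // mcoeff1.
Qed.

Lemma fseries_mulDl : left_distributive fseries_mul +%R.
Proof.
move=> f g h; apply/funext => m.
rewrite [LHS]/fseries_mul; under eq_bigr => p _ do rewrite [X in X * _]/(f p.1 + g p.1) mulrDl.
by rewrite big_split.
Qed.

Lemma fseries_1neq0 : zexp 0%MM != 0 :> fseries k R.
Proof.
apply/eqP => /(congr1 (fun f : fseries k R => f 0%MM)); rewrite /zexp eqxx.
by move/eqP; rewrite oner_eq0.
Qed.

HB.instance Definition _ := GRing.Zmodule_isComNzRing.Build (fseries k R)
  fseries_mulA fseries_mulC fseries_mul1 fseries_mulDl fseries_1neq0.

Lemma fseriesDE f g m : (f + g) m = f m + g m. Proof. by []. Qed.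
Lemma fseriesNE f m : (- f) m = - f m. Proof. by []. Qed.
Lemma fseriesZE (a : R) f m : (a *: f) m = a * f m. Proof. by []. Qed.
Lemma fseries1E m : (1 : fseries k R) m = (m == 0%MM)%:R. Proof. by []. Qed.
Lemma fseriesME f g m : (f * g) m =
  \sum_(p : 'X_{1..k < (mdeg m).+1, (mdeg m).+1} | m == (p.1 + p.2)%MM)
     f p.1 * g p.2.
Proof. by []. Qed.

(* A series is invertible iff its constant term c is, and then the inverse   *)
(* is c^-1 times the sum of the powers of the series 1 - c^-1 f, which has   *)
(* no constant term.                                                         *)
Definition fseries_unit : pred (fseries k R) :=
  fun f => f 0%MM \is a GRing.unit.

Definition fseries_inv f : fseries k R :=
  if fseries_unit f then
    fun m => ((f 0%MM)^-1 *:
      \sum_(0 <= i < (mdeg m).+1) (1 - (f 0%MM)^-1 *: f) ^+ i : fseries k R) m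
  else f.

Lemma fseriesM0 f g : (f * g) 0%MM = f 0%MM * g 0%MM.
Proof.
rewrite [LHS](@fseries_mulE 1) ?mdeg0 //.
rewrite mcoeffM (bigD1 (BMultinom (ltnSn (mdeg (0%MM : 'X_{1..k}))),
   BMultinom (ltnSn (mdeg (0%MM : 'X_{1..k}))))) /=; last by rewrite addm0.
rewrite !coef_ftrunc ?mdeg0 // big1 ?addr0 // => -[p1 p2] /= /andP[/eqP e].
move=> /negP[]; rewrite xpair_eqE !bmeqP /=.
move/(congr1 mdeg)/esym/eqP: e.
by rewrite [X in _ == X]mdeg0 mdegD addn_eq0 !mdeg_eq0.
Qed.

Lemma fseries_expr_eq0 f i m : f 0%MM = 0 -> (mdeg m < i)%N -> (f ^+ i) m = 0.
Proof.
move=> f0; elim: i m => // i IHi m mi; rewrite exprS.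
rewrite [LHS]/(fseries_mul _ _ m) /fseries_mul big1 //.
move=> [[p1 _] [p2 _]] /= /eqP /(congr1 mdeg); rewrite mdegD => em.
have [->|p0] := eqVneq p1 0%MM; first by rewrite f0 mul0r.
rewrite [X in _ * X]IHi ?mulr0 // -ltnS (leq_trans _ mi) // ltnS em.
by rewrite -[X in (X < _)%N]add0n ltn_add2r lt0n mdeg_eq0.
Qed.

Lemma eq_fseriesM (d : nat) f g1 g2 :
  (forall m, (mdeg m < d)%N -> g1 m = g2 m) ->
  forall m, (mdeg m < d)%N -> (f * g1) m = (f * g2) m.
Proof.
move=> e m md; rewrite [LHS](@fseries_mulE d) // [RHS](@fseries_mulE d) //.
apply: (@eq_mcoeffM d) => // m' md'.
by rewrite !coef_ftrunc // e.
Qed.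

Lemma fseries_sumE (I : Type) (r : seq I) (P : pred I) (F : I -> fseries k R) m :
  (\sum_(i <- r | P i) F i) m = \sum_(i <- r | P i) F i m.
Proof. by elim/big_rec2: _ => // i y x _ <-. Qed.

Lemma fseries_scaleAl (a : R) f g : a *: (f * g) = (a *: f) * g.
Proof.
apply/funext => m; rewrite fseriesZE !fseriesME mulr_sumr.
by apply: eq_bigr => p _; rewrite mulrA.
Qed.

Lemma fseries_mulVx : {in fseries_unit, left_inverse 1 fseries_inv *%R}.
Proof.
move=> f fu; rewrite mulrC; apply/funext => m; have c_u : f 0%MM \is a GRing.unit := fu.
set c := f 0%MM in c_u *; pose u : fseries k R := 1 - c^-1 *: f; pose d := (mdeg m).+1.
have u0 : u 0%MM = 0.
  by rewrite /u fseriesDE fseriesNE fseriesZE fseries1E eqxx -/c mulVr ?subrr.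
rewrite (@eq_fseriesM d _ _ (c^-1 *: \sum_(0 <= i < d) u ^+ i)) //; last first.
  move=> m' md; rewrite /fseries_inv [fseries_unit f]fu -/c -/u.
  rewrite !fseriesZE; congr (_ * _).
  rewrite !fseries_sumE [RHS](@big_cat_nat _ _ _ (mdeg m').+1) //=.
  rewrite [X in _ + X]big1_seq ?addr0 // => i /=; rewrite mem_index_iota.
  by case/andP=> lei _; rewrite fseries_expr_eq0.
rewrite mulrC -fseries_scaleAl mulrC fseries_scaleAl.
have -> : c^-1 *: f = 1 - u by rewrite /u opprB addrC subrK.
have -> : (1 - u) * \sum_(0 <= i < d) u ^+ i = 1 - u ^+ d.
  by rewrite big_mkord -(opprB u) mulNr -subrX1 opprB.
by rewrite fseriesDE fseriesNE fseries_expr_eq0 // subr0.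
Qed.

Lemma fseries_unitPl f g : g * f = 1 -> fseries_unit f.
Proof.
move=> /(congr1 (fun h : fseries k R => h 0%MM)); rewrite fseriesM0.
rewrite fseries1E eqxx => e.
by apply/unitrP; exists (g 0%MM); split=> //; rewrite mulrC.
Qed.

Lemma fseries_inv_out : {in [predC fseries_unit], fseries_inv =1 id}.
Proof. by move=> f /negbTE fN; rewrite /fseries_inv [fseries_unit f]fN. Qed.

HB.instance Definition _ := GRing.ComNzRing_hasMulInverse.Build (fseries k R)
  fseries_mulVx fseries_unitPl fseries_inv_out.

Lemma zexpD a b : zexp (a + b)%MM = zexp a * zexp b.
Proof.
apply/funext => m; rewrite fseriesME /zexp.
under eq_bigr => p _ do rewrite -natrM mulnb.
case: eqVneq => [->|nab].
  have ha : (mdeg a < (mdeg (a + b)%MM).+1)%N by rewrite mdegD ltnS leq_addr.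
  have hb : (mdeg b < (mdeg (a + b)%MM).+1)%N by rewrite mdegD ltnS leq_addl.
  rewrite (bigD1 (BMultinom ha, BMultinom hb)) //= !eqxx big1 ?addr0 //.
  move=> [p1 p2] /= /andP[_]; rewrite xpair_eqE !bmeqP /=.
  by move=> /negbTE ->.
rewrite big1 // => -[p1 p2] /= /eqP mp; case: eqVneq => // e1.
by case: eqVneq => // e2; case/eqP: nab; rewrite mp e1 e2.
Qed.

End SeriesRing.

(* Infinite products and sums of series converge coefficientwise, every      *)
(* coefficient being eventually constant. [infprod F] is the product of the  *)
(* F j over j >= 1 (the factor F 0 is not used); both [infprod F] and        *)
(* [infsum A F] are junk unless F is multipliable, resp. summable over A.    *)
Section Infinite.
Context {k : nat} {R : comUnitRingType}.

Definition stable_from (F : nat -> fseries k R) (m : 'X_{1..k}) : set nat :=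
  [set N | forall N', (N <= N')%N ->
     (\prod_(1 <= j < N'.+1) F j) m = (\prod_(1 <= j < N.+1) F j) m].

Definition multipliable (F : nat -> fseries k R) : Prop :=
  forall m, exists N, stable_from F m N.

Definition infprod (F : nat -> fseries k R) : fseries k R := fun m =>
  (\prod_(1 <= j < (xget 0%N (stable_from F m)).+1) F j) m.

Definition summable (T : choiceType) (A : set T) (F : T -> fseries k R) : Prop :=
  forall m, finite_set [set x | A x /\ F x m != 0].

Definition infsum (T : choiceType) (A : set T) (F : T -> fseries k R)
  : fseries k R := fun m => \sum_(x \in A) F x m.

End Infinite.

(* ------------------------------------------------------------------------ *)
(* Type A_n^(1): I = 'I_n.+1, and alpha_i is the monomial U_(i).             *)
(* ------------------------------------------------------------------------ *)

Definition simple_root (n : nat) (i : 'I_n.+1) : 'X_{1..n.+1} := U_(i)%MM.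

Definition delta (n : nat) : 'X_{1..n.+1} := (\sum_(i < n.+1) simple_root i)%MM.

(* ------------------------------------------------------------------------ *)
(* Generalized Young walls: finite sets of sites (row, column), both         *)
(* numbered from 1. Colors live in the additive group 'I_n.+1 = Z/(n+1).     *)
(* ------------------------------------------------------------------------ *)

Local Open Scope fset_scope.
Local Open Scope nat_scope.

Definition site : choiceType := (nat * nat)%type.
Notation wall := {fset site}.

Section Walls.
Variable n : nat.
Implicit Types (Y : wall) (b : site).

Definition color b : 'I_n.+1 := (inZp b.1 - inZp b.2)%R.

Definition gyw Y : Prop := forall j c, (j, c) \in Y ->
  [/\ 0 < j, 0 < c & forall c', 0 < c' <= c -> (j, c') \in Y].

Definition nrow Y (k : nat) : nat := #|` [fset b in Y | b.1 == k]|.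

Definition proper_wall Y : Prop := forall k l, 0 < l < k ->
  k = l %[mod n.+1] -> nrow Y k <= nrow Y l.

Definition ncolor Y (i : 'I_n.+1) (k : nat) : nat :=
  #|` [fset b in Y | (b.2 == k) && (color b == i)]|.

Definition removable_delta Y (k : nat) : Prop := exists b : 'I_n.+1 -> site,
  (forall i, [/\ b i \in Y, (b i).2 = k & color (b i) = i]) /\
  gyw (Y `\` [fset b i | i in 'I_n.+1]).

Definition reduced_wall Y : Prop := forall k, ~ removable_delta Y k.

Lemma colorS (j c : nat) : color (j, c.+1) = (color (j, c) - inZp 1)%R.
Proof.
rewrite /color /= -addrA -opprD; congr (_ - _)%R.
by apply: val_inj; rewrite /= modnDml modnDmr addn1.
Qed.

Lemma ltn_ncolorP Y i k : gyw Y -> 0 < k ->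
  ncolor Y (i - inZp 1)%R k.+1 < ncolor Y i k <->
  exists j, [/\ (j, k) \in Y, color (j, k) = i & (j, k.+1) \notin Y].
Proof.
move=> gY k0; pose A i c := [fset b in Y | (b.2 == c) && (color b == i)].
have inA i' c j c' : ((j, c') \in A i' c) =
    [&& (j, c') \in Y, c' == c & color (j, c') == i'] by rewrite !inE.
pose P := [fset ((b.1, k) : site) | b in A (i - inZp 1)%R k.+1].
have cP : #|` P| = ncolor Y (i - inZp 1)%R k.+1.
  apply: card_in_imfset => -[j c] [j' c'] /=; rewrite !inA.
  by move=> /and3P[_ /eqP-> _] /and3P[_ /eqP-> _] [->].
have sP : P `<=` A i k.
  apply/fsubsetP => b /imfsetP[[j c]] /=; rewrite inA.
  move=> /and3P[jc /eqP ec]; rewrite ec colorS subr_eq subrK => /eqP ci ->.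
  rewrite inA eqxx ci eqxx !andbT; have [_ _] := gY _ _ jc; apply.
  by rewrite k0 ec leqnSn.
have memP j : ((j, k) \in P) = ((j, k.+1) \in A (i - inZp 1)%R k.+1).
  apply/imfsetP/idP => /= [[[j' c'] + [->]]|jA]; last by exists (j, k.+1).
  by move=> jA; have := jA; rewrite {1}inA => /and3P[_ /eqP e _]; move: jA; rewrite e.
rewrite -cP; split => [lt|[j [jY cj jN]]].
  have /fsubsetPn[[j c]] : ~~ (A i k `<=` P).
    by apply: contraTN lt => /fsubset_leq_card; rewrite -leqNgt.
  rewrite inA => /and3P[+ /eqP ec +]; rewrite ec memP => jY /eqP cj jN; exists j.
  by split=> //; apply: contra jN => jS; rewrite inA jS colorS cj !eqxx.
apply: fproper_ltn_card; rewrite fproperE sP; apply/fsubsetPn; exists (j, k).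
  by rewrite inA jY cj !eqxx.
by rewrite memP inA (negbTE jN).
Qed.

Lemma removable_deltaP Y k : gyw Y ->
  removable_delta Y k <->
  forall i, ncolor Y (i - inZp 1)%R k.+1 < ncolor Y i k.
Proof.
move=> gY; have [->|k0] := posnP k.
  split=> [[b [bP _]]|/(_ 0%R)].
    have [+ + _] := bP 0%R; case: (b 0%R) => j c /= jY c0.
    by have [_] := gY _ _ jY; rewrite c0.
  rewrite [X in _ < X]/ncolor (_ : [fset b in Y | _] = fset0) ?cardfs0 //.
  apply/fsetP => -[j c]; rewrite !inE /=; apply/negbTE/negP.
  by case/andP=> /gY[_ c0 _] /andP[/eqP e _]; rewrite e in c0.
split=> [[b [bP gB]] i|h].
  apply/ltn_ncolorP => //; have [] := bP i; case bi: (b i) => [j c] /= jY ck ci.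
  rewrite ck in bi jY ci; exists j; split=> //; apply/negP => jS.
  have jB : (j, k.+1) \in Y `\` [fset b i | i in 'I_n.+1].
    rewrite in_fsetD jS andbT; apply/negP => /imfsetP[i' _ /= e].
    by have [_ + _] := bP i'; rewrite -e /= => /eqP; rewrite gtn_eqF.
  have [_ _ /(_ k)] := gB _ _ jB; rewrite k0 leqnSn => /(_ isT).
  by rewrite in_fsetD -bi in_imfset.
have {}h i : exists j, [/\ (j, k) \in Y, color (j, k) = i & (j, k.+1) \notin Y].
  by apply/ltn_ncolorP.
have [r rP] := choice h.
exists (fun i => (r i, k)); split=> [i|j c]; first by have [] := rP i.
rewrite in_fsetD => /andP[jcN jc]; have [j0 c0 jr] := gY _ _ jc.
split=> // c' /andP[c'0 c'c]; rewrite in_fsetD jr ?c'0 // andbT.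
apply: contra jcN => /imfsetP[i _ /= [ej ec']]; have [_ _ jN] := rP i.
have [ck|ck] := leqP c k.
  have -> : c = k by apply/eqP; rewrite eqn_leq ck -ec'.
  by rewrite ej; apply/imfsetP; exists i.
by case/negP: jN; rewrite -ej jr.
Qed.

Definition Yinf : set wall :=
  [set Y | [/\ gyw Y, proper_wall Y & reduced_wall Y]].

Definition Y0 : set wall :=
  [set Y | Yinf Y /\ forall k, 0 < k -> n.+1 %| k -> nrow Y k = 0].

Definition Sset Y (j : nat) : set nat := range (fun m => nrow Y (n.+1 * m + j)).

(* nrow Y (n.+1 * m.+1) = n.+1 ^ pexp Y m * qfac Y m; on an empty row the    *)
(* maximum ranges over p = 0 only, so that both are 0.                       *)
Definition pexp Y (m : nat) : nat :=
  \max_(p < (nrow Y (n.+1 * m.+1)).+1 | n.+1 ^ p %| nrow Y (n.+1 * m.+1)) p.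

Definition qfac Y (m : nat) : nat :=
  nrow Y (n.+1 * m.+1) %/ n.+1 ^ pexp Y m.

Definition Qset Y : set nat :=
  ([set x | exists m s, s < pexp Y m /\ x = n.+1 ^ s * qfac Y m]
     `|` [set 0])%classic.

Definition Pstat Y : nat :=
  \big[addn/0]_(t \in [set t | 0 < t /\ ~~ (n.+1 %| t)])
    \big[maxn/0]_(m \in [set m | qfac Y m = t]) pexp Y m.

Definition Nstat Y : nat :=
  n * Pstat Y
  + \sum_(1 <= j < n.+2) #|` fset_set (Sset Y j `\` Qset Y)%classic|.

Definition Mrows Y (i : nat) : nat :=
  #|` fset_set [set k | [/\ 0 < k, k = i %[mod n.+1] & 0 < nrow Y k]]|.

Definition Mstat Y : nat := \sum_(1 <= i < n.+1) i.+1 * Mrows Y i.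

End Walls.

(* Main.v *)
Require Import Defs.
From HB Require Import structures.
From mathcomp Require Import all_boot all_order all_algebra.
From mathcomp Require Import finmap.
From mathcomp Require Import boolp classical_sets functions cardinality fsbigop.
From mathcomp Require Import mpoly.

Set Implicit Arguments.
Unset Strict Implicit.
Unset Printing Implicit Defensive.

Import GRing.Theory.

Local Open Scope ring_scope.

(* In a wall of Y0 the rows in positions = 0 mod n+1 are empty, which rules out
   removable deltas, so a wall is just an n-tuple of partitions: the parts of
   the i-th one are the lengths of the rows in positions = i. Moreover
   Q(Y) = {0} and P(Y) = 0, so N(Y) counts the distinct parts and M(Y) weights
   each part of the i-th partition by i+1. On the other side, for
   x = q^-(i+1) z^(j delta),
     (1 - q x) / (1 - x) = 1 + (1 - q) (x + x^2 + ...),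
   where the exponent of x is the multiplicity of the part j in the i-th
   partition. Below any given degree only finitely many factors and terms
   matter, and expanding the product of the truncated geometric series gives
   the sum over families of multiplicities, that is, over walls. *)

(** * Series modulo terms of high degree, and truncated geometric series *)

Section SeriesCongruence.
Context {k : nat} {R : comUnitRingType}.
Implicit Types (f g x : fseries k R) (F : nat -> fseries k R).

HB.instance Definition _ :=
  GRing.Lmodule_isLalgebra.Build R (fseries k R) fseries_scaleAl.
HB.instance Definition _ := GRing.Lalgebra_isComAlgebra.Build R (fseries k R).

Definition eqdeg (d : nat) f g := forall m, (mdeg m < d)%N -> f m = g m.

Lemma eqdegM d f f' g g' :
  eqdeg d f f' -> eqdeg d g g' -> eqdeg d (f * g) (f' * g').
Proof.
move=> ef eg m md; rewrite (eq_fseriesM _ eg) // (mulrC f) (mulrC f').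
exact: eq_fseriesM ef m md.
Qed.

Lemma eqdeg_prod d (I : Type) (r : seq I) (P : pred I) (F G : I -> fseries k R) :
  (forall i, P i -> eqdeg d (F i) (G i)) ->
  eqdeg d (\prod_(i <- r | P i) F i) (\prod_(i <- r | P i) G i).
Proof.
move=> eFG; elim/big_rec2: _ => [//|i f g Pi fg].
exact: eqdegM (eFG i Pi) fg.
Qed.

Lemma eqdeg_prod_tail d D F N : (forall j, (D < j)%N -> eqdeg d (F j) 1) ->
  (D <= N)%N -> eqdeg d (\prod_(1 <= j < N.+1) F j) (\prod_(1 <= j < D.+1) F j).
Proof.
move=> F1 DN; rewrite (@big_cat_nat _ _ _ D.+1) //= -[X in eqdeg d _ X]mulr1.
apply: eqdegM => //.
rewrite -[X in eqdeg d _ X](_ : \prod_(D.+1 <= j < N.+1) 1 = 1);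
  last by rewrite big1_eq.
rewrite big_seq [X in eqdeg d _ X]big_seq.
by apply: eqdeg_prod => j; rewrite mem_index_iota => /andP[Dj _]; exact: F1.
Qed.

Lemma eqdeg1_multipliable F :
  (forall d j, (d <= j)%N -> eqdeg d (F j) 1) -> multipliable F.
Proof.
move=> F1 m; exists (mdeg m) => N mN.
apply: (@eqdeg_prod_tail (mdeg m).+1) => // j; exact: F1.
Qed.

Lemma eqdeg_infprod d D F : (d <= D.+1)%N ->
  (forall d' j, (d' <= j)%N -> eqdeg d' (F j) 1) ->
  eqdeg d (infprod F) (\prod_(1 <= j < D.+1) F j).
Proof.
move=> dD F1 m md; rewrite /infprod.
have sD : stable_from F m D.
  move=> N DN; apply: (@eqdeg_prod_tail d) => // j Dj.
  by apply: F1; apply: leq_trans Dj.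
have sx := xgetI 0%N sD; set x := xget _ _ in sx *.
(* [xget] returns some stable index [x], not a known one. Both [x] and [D] are stable, so the
   smaller one compares the two partial products. *)
have [xD|/ltnW Dx] := leqP x D; last exact: sD.
by rewrite (sx D xD).
Qed.

Definition geom_coef (q : R) (e : nat) : R := (1 - q) ^+ (0 < e)%N.

(** Finite form of the expansion of [(1 - q x) / (1 - x)]: multiplication by [1 - x] makes the sum
    telescope, up to one remainder in [x ^+ D.+1]. *)
Lemma geom_telescope (q : R) x (D : nat) :
  (1 - x) * (\sum_(e < D.+1) geom_coef q e *: x ^+ e) + (1 - q) *: x ^+ D.+1
  = 1 - q *: x.
Proof.
elim: D => [|D IHD].
  rewrite big_ord1 /geom_coef expr0 scale1r expr0 mulr1 expr1 scalerBl scale1r.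
  by rewrite addrA subrK.
rewrite -[RHS]IHD big_ord_recr /= mulrDr -addrA; congr (_ + _).
by rewrite /geom_coef expr1 -scalerAr -scalerDr mulrBl mul1r -exprS subrK.
Qed.

(** Since [x] has no constant term, [1 - x] is invertible and the remainder in [x ^+ D.+1] has no
    terms of degree below [d]. *)
Lemma eqdeg_geom d D (q : R) x : x 0%MM = 0 -> (d <= D.+1)%N ->
  eqdeg d ((1 - q *: x) / (1 - x)) (\sum_(e < D.+1) geom_coef q e *: x ^+ e).
Proof.
move=> x0 dD; rewrite -(geom_telescope q x D) mulrDl.
have Ux : 1 - x \is a GRing.unit.
  rewrite unfold_in /= /fseries_unit fseriesDE fseriesNE fseries1E eqxx x0 subr0.
  exact: unitr1.
rewrite [_ * (\sum_(_ < _) _)]mulrC mulrK // => m md; rewrite fseriesDE.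
have e0 : eqdeg d ((1 - q) *: x ^+ D.+1) 0.
  move=> m' md'; rewrite fseriesZE fseries_expr_eq0 ?mulr0 //.
  exact: leq_trans md' dD.
by rewrite (eqdegM e0 (fun _ _ => erefl)) // mul0r addr0.
Qed.

Lemma zexpM (a : 'X_{1..k}) e : zexp (a *+ e)%MM = zexp a ^+ e :> fseries k R.
Proof. by elim: e => [|e IHe]; rewrite ?mulm0n // mulmS zexpD IHe exprS. Qed.

End SeriesCongruence.

Local Open Scope fset_scope.
Local Open Scope nat_scope.

(** * Counting, and initial segments of the natural numbers *)

Lemma card_ord_lt (B h : nat) : h <= B -> #|[pred i : 'I_B | i < h]| = h.
Proof.
by move=> hB; rewrite -sum1_card -(big_ord_widen _ (fun=> 1)) // sum1_card card_ord.
Qed.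

(** A down-closed set containing [x] contains [0, ..., x]; one missing [x] lies inside
    [0, ..., x - 1]. Comparing cardinalities gives both directions. *)
Lemma mem_downclosed (A : {fset nat}) x :
  (forall y z, z <= y -> y \in A -> z \in A) -> (x \in A) = (x < #|` A|).
Proof.
move=> dA; apply/idP/idP => [xA|].
  rewrite -{1}(size_iota 0 x.+1); apply: uniq_leq_size => [|y].
    exact: iota_uniq.
  by rewrite mem_iota add0n ltnS => /= yx; apply: dA xA.
apply: contraTT => xA; rewrite -leqNgt -[leqRHS](size_iota 0 x).
apply: uniq_leq_size => [|y yA]; first exact: fset_uniq.
rewrite mem_iota add0n /= ltnNge; apply: contra xA => xy; exact: dA yA.
Qed.

Lemma card_fset_set_image (I : finType) (T : choiceType) (f : I -> T)
    (P : pred I) (A : set T) : {in P &, injective f} ->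
  A = [set` [fset f i | i in P]]%classic -> #|` fset_set A| = #|P|.
Proof. by move=> f_inj ->; rewrite set_fsetK card_in_imfset //= -cardE. Qed.

Lemma gyw_mem_nrow (Y : wall) r c :
  gyw Y -> 0 < c -> ((r, c) \in Y) = (c <= nrow Y r).
Proof.
move=> gY; case: c => // c _; rewrite /nrow.
pose A := [fset b.2.-1 | b in [fset b in Y | b.1 == r]].
have inA x : (x \in A) = ((r, x.+1) \in Y).
  apply/imfsetP/idP => /= [[[r' c'] + ->]|rx]; last first.
    by exists (r, x.+1) => //; rewrite !inE rx /=.
  rewrite !inE /= => /andP[rc /eqP <-].
  by have [_ c0 _] := gY _ _ rc; rewrite prednK.
rewrite -inA mem_downclosed => [|y z zy].
  congr (_ < _); apply: card_in_imfset => -[r1 c1] [r2 c2] /=.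
  rewrite !inE /= => /andP[rc1 /eqP ->] /andP[rc2 /eqP ->] e; congr (_, _).
  have [_ + _] := gY _ _ rc1; have [_ + _] := gY _ _ rc2.
  by case: c1 c2 e {rc1 rc2} => [|?] [|?] //= ->.
rewrite !inA => /gY[_ _]; apply; exact: zy.
Qed.

(** * Column heights of the walls in [Y0], one residue class of rows at a time *)

Section Walls.
Context (n : nat).
Implicit Types Y : wall.

Lemma gyw_nrow0 Y : gyw Y -> nrow Y 0 = 0.
Proof.
move=> gY; apply/eqP; rewrite -leqn0 leqNgt -(gyw_mem_nrow _ gY) //.
by apply/negP => /gY[].
Qed.

Lemma Y0_nrow0 Y k : Y0 n Y -> k = 0 %[mod n.+1] -> nrow Y k = 0.
Proof.
move=> [[gY _ _] Y0] k0; have [->|kp] := posnP k; first exact: gyw_nrow0.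
by apply: Y0 => //; rewrite /dvdn k0 mod0n.
Qed.

(** As [c >= 1] varies, these are the parts of the conjugate of the partition formed by the row
    lengths in class [a]. *)
Definition colheight Y (a c : nat) : nat :=
  #|` [fset b in Y | (b.2 == c) && (b.1 %% n.+1 == a)]|.

(** By properness the row lengths of a class weakly decrease upwards, so the rows reaching column
    [c] are the lowest ones of the class. *)
Lemma Y0_mem Y r c : Y0 n Y ->
  ((r, c) \in Y) = (r %/ n.+1 < colheight Y (r %% n.+1) c).
Proof.
move=> Y0Y; have [[gY pY _] _] := Y0Y.
set a := r %% n.+1; have an : a < n.+1 by rewrite ltn_mod.
pose A := [fset b.1 %/ n.+1 | b in [fset b in Y | (b.2 == c) && (b.1 %% n.+1 == a)]].
have inA x : (x \in A) = ((x * n.+1 + a, c) \in Y).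
  apply/imfsetP/idP => /= [[[r' c'] + ->]|rx]; last first.
    exists (x * n.+1 + a, c); last by rewrite /= divnMDl // divn_small // addn0.
    by rewrite !inE rx /= eqxx modnMDl modn_small /=.
  by rewrite !inE /= => /andP[rc /andP[/eqP <- /eqP <-]]; rewrite -divn_eq.
have -> : ((r, c) \in Y) = (r %/ n.+1 \in A) by rewrite inA -divn_eq.
rewrite mem_downclosed => [|y z zy].
  congr (_ < _); apply: card_in_imfset => -[r1 c1] [r2 c2] /=.
  rewrite !inE /= => /andP[_ /andP[/eqP-> /eqP e1]] /andP[_ /andP[/eqP-> /eqP e2]].
  by move=> e; rewrite (divn_eq r1 n.+1) e e1 -e2 -divn_eq.
rewrite !inA => yY; have [r0 c0 _] := gY _ _ yY.
move: yY; rewrite !gyw_mem_nrow // => /leq_trans; apply.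
(* Properness says nothing about row number 0, so the class of 0 is settled by the emptiness of its
   rows. *)
have [a0|a0] := posnP a.
  by rewrite Y0_nrow0 // a0 addn0 modnMl mod0n.
have [->//|zy'] := eqVneq z y.
apply: pY; last by rewrite !modnMDl.
by rewrite addn_gt0 a0 orbT /= ltn_add2r ltn_pmul2r // ltn_neqAle zy' zy.
Qed.

Lemma colheight_bound Y a c : colheight Y a c <= #|` Y|.
Proof. by apply: fsubset_leq_card; apply: fset_sub. Qed.

Lemma nrow_bound Y r : nrow Y r <= #|` Y|.
Proof. by apply: fsubset_leq_card; apply: fset_sub. Qed.

Lemma Y0_colheight_gt Y a c : Y0 n Y -> #|` Y| < c -> colheight Y a c = 0.
Proof.
move=> [[gY _ _] _] Yc; apply/eqP; rewrite cardfs_eq0; apply/eqP/fsetP => -[r c'].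
rewrite !inE /=; apply/negP => /andP[rcY /andP[/eqP e _]]; subst c'.
move: rcY; rewrite gyw_mem_nrow // ?(leq_ltn_trans _ Yc) //.
by apply/negP; rewrite -ltnNge; apply: leq_ltn_trans (nrow_bound _ _) Yc.
Qed.

Lemma Y0_colheightS Y a c : Y0 n Y -> a < n.+1 -> 0 < c ->
  colheight Y a c.+1 <= colheight Y a c.
Proof.
move=> Y0Y an c0; have [[gY _ _] _] := Y0Y.
(* The lowest row of the class that misses column [c]; a greater height in column [c.+1] would make
   it reach that column, leaving a gap. *)
pose r := colheight Y a c * n.+1 + a.
have rE c' : ((r, c') \in Y) = (colheight Y a c < colheight Y a c').
  by rewrite Y0_mem // /r divnMDl // divn_small // addn0 modnMDl modn_small.
rewrite leqNgt -rE; apply/negP => rc.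
have [_ _ /(_ c)] := gY _ _ rc; rewrite c0 leqnSn => /(_ isT).
by rewrite rE ltnn.
Qed.

Lemma Y0_colheight0 Y c : Y0 n Y -> colheight Y 0 c = 0.
Proof.
move=> Y0Y; have [[gY _ _] _] := Y0Y.
apply/eqP; rewrite -leqn0 leqNgt; apply/negP => h0.
have : (0, c) \in Y by rewrite Y0_mem // mod0n div0n.
by case/gY.
Qed.

Lemma Y0_Qset Y : Y0 n Y -> Qset n Y = [set 0]%classic.
Proof.
move=> Y0Y; apply/seteqP; split=> [x [[m [s []]]|//]|x]; last by right.
suff -> : pexp n Y m = 0 by [].
rewrite /pexp Y0_nrow0 ?modnMr ?mod0n // big_mkcond big_ord_recl big_ord0.
by case: (dvdn _ _).
Qed.

(** Every [qfac] vanishes on an empty row, so no positive [t] is attained and each inner maximum is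
    empty. *)
Lemma Y0_Pstat Y : Y0 n Y -> Pstat n Y = 0.
Proof.
move=> Y0Y; apply: fsbig1 => t [t0 _]; apply: fsbig1 => m /= mt; move: t0.
by rewrite -mt /qfac Y0_nrow0 ?modnMr ?mod0n // div0n.
Qed.

(** * The bijection between bounded multiplicities and walls *)

Section WallOfMultiplicities.
Context (D : nat).

(* [mu (i, j)] is the number of rows of length [j.+1] in the positions
   congruent to [i.+1] modulo [n.+1]. *)
Definition mult : finType := {ffun 'I_n * 'I_D -> 'I_D.+1}.
Implicit Types mu : mult.

(** The column height prescribed by [mu]: the number of parts at least [c] in the partition of class
    [a]. *)
Definition height mu (a c : nat) : nat :=
  \sum_(p : 'I_n * 'I_D | (p.1.+1 == a) && (c <= p.2.+1)) mu p.

(** A box is coded by the residue of its row, its column, and the index of its row in the class. The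
    bound [\sum_p mu p] exceeds no row index wrongly, as it dominates all heights; it makes the
    codes a finite type. *)
Definition wall_of mu : wall :=
  [fset ((t.2 * n.+1 + t.1.1, t.1.2.+1) : site)
    | t : 'I_n.+1 * 'I_D * 'I_(\sum_p mu p)
      in [pred t : 'I_n.+1 * 'I_D * 'I_(\sum_p mu p) |
           t.2 < height mu t.1.1 t.1.2.+1]].

Lemma height_bound mu a c : height mu a c <= \sum_p mu p.
Proof.
pose P (p : 'I_n * 'I_D) := (p.1.+1 == a) && (c <= p.2.+1).
by rewrite [leqRHS](bigID P) leq_addr.
Qed.

Lemma height0 mu c : height mu 0 c = 0.
Proof. by rewrite /height big1. Qed.

Lemma height_gt mu a c : D < c -> height mu a c = 0.
Proof.
move=> Dc; rewrite /height big_pred0 // => p; apply/negbTE; rewrite negb_and.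
by rewrite -(ltnNge p.2.+1 c) (leq_ltn_trans _ Dc) ?orbT.
Qed.

Lemma heightS mu (i : 'I_n) (j : 'I_D) :
  height mu i.+1 j.+1 = mu (i, j) + height mu i.+1 j.+2.
Proof.
rewrite /height (bigD1 (i, j)) ?eqxx ?leqnn //=; congr (_ + _).
apply: eq_bigl => -[i' j'] /=; rewrite eqSS xpair_eqE !ltnS -val_eqE /=.
case: eqP => //= _; rewrite [RHS]ltn_neqAle andbC.
by rewrite -val_eqE /= eq_sym.
Qed.

Lemma heightS_le mu a c : height mu a c.+1 <= height mu a c.
Proof.
rewrite /height [leqRHS](bigID (fun p : 'I_n * 'I_D => c < p.2.+1)) /=.
rewrite -[leqLHS]addn0.
apply: leq_add => //; apply: eq_leq; apply: eq_bigl => p.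
by rewrite -andbA; congr andb; case: ltnP => [/ltnW ->|]; rewrite ?andbF.
Qed.

Lemma in_wall_of mu r c : ((r, c) \in wall_of mu) =
  (0 < c) && (r %/ n.+1 < height mu (r %% n.+1) c).
Proof.
apply/imfsetP/andP => /= [[[[a c'] m] + [-> ->]]|[c0 rh]].
  by rewrite divnMDl // divn_small // addn0 modnMDl modn_small.
have cD : c.-1 < D.
  by rewrite prednK // leqNgt; apply: contraTN rh => /(height_gt mu (r %% n.+1)) ->.
have an : r %% n.+1 < n.+1 by rewrite ltn_mod.
have rB := leq_trans rh (height_bound mu (r %% n.+1) c).
exists (Ordinal an, Ordinal cD, Ordinal rB); first by rewrite unfold_in /= prednK.
by rewrite /= prednK // -divn_eq.
Qed.

Lemma wall_of_gyw mu : gyw (wall_of mu).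
Proof.
move=> r c; rewrite in_wall_of => /andP[c0 rh]; split=> // [|c'].
  by rewrite lt0n; apply: contraTneq rh => ->; rewrite mod0n height0.
case/andP=> c'0 c'c; rewrite in_wall_of c'0 (leq_trans rh) //.
rewrite -(subnKC c'c); elim: (c - c') => [|e]; first by rewrite addn0.
by rewrite addnS; apply: leq_trans; apply: heightS_le.
Qed.

Lemma wall_of_mem_nrow mu r c : 0 < c ->
  (c <= nrow (wall_of mu) r) = (r %/ n.+1 < height mu (r %% n.+1) c).
Proof.
by move=> c0; rewrite -(gyw_mem_nrow _ (@wall_of_gyw mu)) // in_wall_of c0.
Qed.

Lemma wall_of_nrow0 mu r : r %% n.+1 = 0 -> nrow (wall_of mu) r = 0.
Proof.
move=> r0; apply/eqP; rewrite -leqn0 leqNgt wall_of_mem_nrow //.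
by rewrite r0 height0.
Qed.

Lemma wall_of_Y0 mu : Y0 n (wall_of mu).
Proof.
split=> [|k _ kn]; last exact/wall_of_nrow0/eqP.
have gY := @wall_of_gyw mu; split=> // [r s /andP[s0 sr] rs|k [b [bP _]]].
  case e: (nrow _ r) => [//|c]; rewrite wall_of_mem_nrow //.
  have : c < nrow (wall_of mu) r by rewrite e.
  rewrite wall_of_mem_nrow // rs; apply: leq_ltn_trans.
  exact/leq_div2r/ltnW.
(* A removable delta in column [k] would include a box with the color of the site [(0, k)]. Its row
   number is divisible by [n.+1], but such rows are empty. *)
have [] := bP (color n (0, k)); case: (b _) => r c /= rc -> /(congr1 val) /=.
move=> /eqP; rewrite eqn_modDr !mod0n modn_mod => /eqP r0.
by move: rc; rewrite in_wall_of r0 height0 ltn0 andbF.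
Qed.

(** The boxes determine the heights, and a multiplicity is the difference of two consecutive
    heights. *)
Lemma wall_of_inj : injective wall_of.
Proof.
move=> mu mu' e; have eh a c : a < n.+1 -> 0 < c -> height mu a c = height mu' a c.
  move=> an c0; have mE m : (m < height mu a c) = (m < height mu' a c).
    have := in_wall_of mu (m * n.+1 + a) c; rewrite e in_wall_of c0.
    by rewrite divnMDl // divn_small // addn0 modnMDl modn_small //= => ->.
  by apply/eqP; rewrite eqn_leq leqNgt mE ltnn /= leqNgt -mE ltnn.
apply/ffunP => -[i j]; apply/val_inj/eqP.
have := eh i.+1 j.+1 (ltn_ord i) isT; rewrite !heightS eh ?ltnS //.
by move=> /eqP; rewrite eqn_add2r.
Qed.

Lemma wall_of_surj Y : Y0 n Y -> #|` Y| <= D -> exists mu, wall_of mu = Y.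
Proof.
move=> Y0Y YD; have [[gY _ _] _] := Y0Y.
pose mu : mult := [ffun p : 'I_n * 'I_D =>
  inord (colheight Y p.1.+1 p.2.+1 - colheight Y p.1.+1 p.2.+2)].
(* Descending induction on the column, from [D.+1], where both heights vanish, down to column 1. The
   alternative [D < e] discards column 0. *)
have hE a e : a < n.+1 -> height mu a (D.+1 - e) = colheight Y a (D.+1 - e) \/ D < e.
  case: a => [|a an].
    by rewrite height0 Y0_colheight0 //; left.
  elim: e => [|e IHe].
    by left; rewrite subn0 height_gt // Y0_colheight_gt.
  have [eD|] := ltnP e D; last by right.
  case: IHe => [IHe|]; last by rewrite ltnNge (ltnW eD).
  left; rewrite subSS; have jD : D - e.+1 < D by rewrite ltn_subLR // ltnS leq_addl.
  have eS : D - e = (D - e.+1).+1 by rewrite subnSK.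
  have := heightS mu (Ordinal (an : a < n)) (Ordinal jD); rewrite /= -eS => ->.
  rewrite -subSn ?(ltnW eD) // IHe ffunE /= -eS -subSn ?(ltnW eD) //.
  (* The difference is at most the number of boxes of [Y], hence at most [D], so [inord] keeps its
     value. *)
  rewrite inordK; last first.
    rewrite ltnS (leq_trans (leq_subr _ _)) //.
    exact: leq_trans (colheight_bound _ _ _) YD.
  rewrite subnK // subSn ?(ltnW eD) //; apply: Y0_colheightS => //.
  by rewrite subn_gt0.
exists mu; apply/fsetP => -[r c]; rewrite in_wall_of (Y0_mem _ _ Y0Y).
have an : r %% n.+1 < n.+1 by rewrite ltn_mod.
case: c => [|c] /=.
  by apply/esym/negbTE; rewrite -Y0_mem //; apply/negP => /gY[].
congr (_ < _); have [cD|Dc] := ltnP c D; last first.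
  by rewrite height_gt // Y0_colheight_gt // ltnS (leq_trans YD).
case: (hE (r %% n.+1) (D - c) an); last by rewrite ltnNge leq_subr.
by rewrite subSn ?leq_subr // subKn // ltnW.
Qed.

(** * The statistics of a wall in terms of its multiplicities *)

Lemma card_wall_of mu : #|` wall_of mu| = \sum_(p : 'I_n * 'I_D) p.2.+1 * mu p.
Proof.
rewrite card_in_imfset /=; last first.
  move=> [[a1 c1] m1] [[a2 c2] m2] _ _ /= [e ec]; rewrite (val_inj ec).
  have := congr1 (modn^~ n.+1) e; rewrite /= !modnMDl !modn_small // => /val_inj ea.
  by move/eqP: e; rewrite ea eqn_add2r eqn_pmul2r // => /eqP/val_inj ->.
rewrite -cardE -sum1_card; transitivity
  (\sum_(ac : 'I_n.+1 * 'I_D) \sum_(m < \sum_p mu p | m < height mu ac.1 ac.2.+1) 1).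
  by rewrite pair_big_dep.
transitivity (\sum_(ac : 'I_n.+1 * 'I_D) height mu ac.1 ac.2.+1).
  apply: eq_bigr => ac _; rewrite sum1_card card_ord_lt //; exact: height_bound.
(* Exchanging the sums counts boxes by rows: a row of length [p.2.+1] meets exactly that many
   columns. *)
rewrite /height (exchange_big_dep xpredT) //=; apply: eq_bigr => p _.
rewrite sum_nat_const; congr (_ * _).
pose f (c : 'I_D) : 'I_n.+1 * 'I_D := (lift ord0 p.1, c).
transitivity #|[seq f c | c in [pred c : 'I_D | c < p.2.+1]]|; last first.
  by rewrite card_in_image ?card_ord_lt // => c c' _ _ [].
apply: eq_card => -[a c]; rewrite [LHS]unfold_in /=; apply/idP/idP.
  case/andP => /eqP ea cp; apply/mapP; exists c; first by rewrite mem_enum.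
  congr (_, _); exact: val_inj.
by case/mapP=> c'; rewrite mem_enum => c'p [-> ->]; rewrite eqxx.
Qed.

Lemma Mrows_wall_of mu i : 0 < i < n.+1 ->
  Mrows n (wall_of mu) i = \sum_(p : 'I_n * 'I_D | p.1.+1 == i) mu p.
Proof.
case/andP=> i0 iN.
have hE : height mu i 1 = \sum_(p : 'I_n * 'I_D | p.1.+1 == i) mu p.
  by apply: eq_bigl => p; rewrite andbT.
rewrite -hE -[RHS]card_ord; pose f (m : 'I_(height mu i 1)) : nat := m * n.+1 + i.
apply: (@card_fset_set_image _ _ f xpredT) => [m m' _ _ /eqP|].
  by rewrite eqn_add2r eqn_pmul2r // => /eqP/val_inj.
apply/seteqP; split=> k /=.
  move=> [k0 ki]; rewrite wall_of_mem_nrow // ki (modn_small iN) => kh.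
  apply/imfsetP; exists (Ordinal kh) => //=.
  by rewrite /f /= {1}(divn_eq k n.+1) ki modn_small.
case/imfsetP => m _ ->; rewrite /f; split; first by rewrite addn_gt0 i0 orbT.
  by rewrite modnMDl.
by rewrite wall_of_mem_nrow // divnMDl // divn_small // addn0 modnMDl modn_small.
Qed.

Lemma card_Sset_wall_of mu (i : 'I_n) :
  #|` fset_set (Sset n (wall_of mu) i.+1 `\` Qset n (wall_of mu))%classic|
  = \sum_(j < D) (0 < mu (i, j)).
Proof.
rewrite Y0_Qset; last exact: wall_of_Y0.
rewrite -big_mkcond /= sum1_card -[RHS]/(#|[pred j | 0 < mu (i, j)]|).
pose f (j : 'I_D) := j.+1.
apply: (@card_fset_set_image _ _ f [pred j | 0 < mu (i, j)]).
  by move=> j j' _ _ [/val_inj].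
have nE m c : 0 < c ->
    (c <= nrow (wall_of mu) (n.+1 * m + i.+1)) = (m < height mu i.+1 c).
  move=> c0; rewrite wall_of_mem_nrow // mulnC divnMDl // divn_small ?ltnS //.
  by rewrite addn0 modnMDl modn_small ?ltnS.
apply/seteqP; split=> v /=.
  move=> [[m _ <-] /eqP]; set v' := nrow _ _; rewrite -lt0n => v0.
  have h2 : m < height mu i.+1 v' by rewrite -(nE m v' v0).
  have h1 : ~~ (m < height mu i.+1 v'.+1) by rewrite -(nE m v'.+1 isT) ltnn.
  have vD : v'.-1 < D.
    by rewrite prednK // leqNgt; apply: contraTN h2 => /(height_gt mu i.+1) ->.
  apply/imfsetP; exists (Ordinal vD); rewrite /f /= ?prednK // inE.
  rewrite lt0n; apply: contraNneq h1 => e0.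
  (* With multiplicity 0 the heights in columns [v'] and [v'.+1] agree, so row [m] would be longer
     than [v']. *)
  by have := heightS mu i (Ordinal vD); rewrite e0 add0n /= prednK // => <-.
case/imfsetP => j /=; rewrite inE => j0 ->; split=> //.
(* The rows longer than [j.+1] come first in the class; the next one has length exactly [j.+1]. *)
exists (height mu i.+1 j.+2) => //; apply/eqP; rewrite eqn_leq nE //.
by rewrite leqNgt nE // ltnn /= heightS -[X in X < _]add0n ltn_add2r.
Qed.

Lemma Nstat_wall_of mu : Nstat n (wall_of mu) = \sum_p (0 < mu p).
Proof.
have Y0w := wall_of_Y0 mu.
rewrite /Nstat Y0_Pstat // muln0 add0n big_add1 big_mkord big_ord_recr /=.
(* The last class consists of empty rows, whose only value 0 lies in [Qset]. *)
rewrite [X in _ + X](_ : _ = 0) ?addn0.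
  under eq_bigr do rewrite card_Sset_wall_of.
  by rewrite pair_big /=; apply: eq_bigr => -[].
rewrite (_ : (_ `\` _)%classic = set0) ?fset_set0 ?cardfs0 //.
apply/seteqP; split=> // v [[m _ <-]]; rewrite Y0_Qset //=; case.
by rewrite wall_of_nrow0 // -mulnSr modnMr.
Qed.

Lemma Mstat_wall_of mu : Mstat n (wall_of mu) = \sum_(p : 'I_n * 'I_D) p.1.+2 * mu p.
Proof.
rewrite /Mstat big_add1 big_mkord /=.
under eq_bigr => i _ do
  rewrite (Mrows_wall_of mu (i := i.+1) (ltn_ord i)) big_distrr /=.
rewrite (exchange_big_dep xpredT) //=; apply: eq_bigr => p _.
by rewrite (big_pred1 p.1) // => i /=; rewrite eqSS eq_sym.
Qed.

End WallOfMultiplicities.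
End Walls.

Local Open Scope ring_scope.

(** * Expansion of the product and comparison of coefficients *)

Lemma mdeg_delta n : mdeg (delta n) = n.+1.
Proof.
rewrite /delta mdeg_sum (eq_bigr (fun=> 1%N)) => [|i _]; last exact: mdeg1.
by rewrite sum1_card card_ord.
Qed.

Section Expansion.
Context (n : nat) (R : comUnitRingType) (q : R) (q_unit : q \is a GRing.unit).

Let z (j : nat) : fseries n.+1 R := zexp (delta n *+ j)%MM.
Let F (i j : nat) : fseries n.+1 R :=
  (1 - q ^- i *: z j) / (1 - q ^- i.+1 *: z j).
Let G (Y : wall) : fseries n.+1 R :=
  ((1 - q) ^+ Nstat n Y * q ^- Mstat n Y) *: z #|` Y|%fset.

Lemma zdelta_neq0 j m : z j m != 0 -> mdeg m = (n.+1 * j)%N.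
Proof.
rewrite /z /zexp; case: (m =P _) => [-> _|_]; last by rewrite eqxx.
by rewrite mdegMn mdeg_delta.
Qed.

(** Puts the numerator in the form [1 - q *: x], with the [x] of the denominator. *)
Lemma factor_scale i j : q ^- i *: z j = q *: (q ^- i.+1 *: z j).
Proof. by rewrite scalerA -!exprVn exprS mulrA divrr ?mul1r. Qed.

Lemma zdelta_eqdeg0 d j : (d <= j)%N -> eqdeg d (z j) 0.
Proof.
move=> dj m md; apply/eqP; apply: contraTT md => /zdelta_neq0 ->.
by rewrite -leqNgt (leq_trans dj) // leq_pmull.
Qed.

Lemma factor_den_unit i j : (0 < j)%N -> 1 - q ^- i *: z j \is a GRing.unit.
Proof.
move=> j0; rewrite unfold_in /= /fseries_unit fseriesDE fseriesNE fseriesZE.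
by rewrite fseries1E eqxx (zdelta_eqdeg0 j0) ?mdeg0 // mulr0 subr0 unitr1.
Qed.

Lemma factor_eqdeg1 i d j : (d <= j)%N -> eqdeg d (F i j) 1.
Proof.
(* For [j = 0] the denominator need not be invertible, but then [d = 0] and the congruence is
   vacuous. *)
case: (posnP j) => [->|j0]; first by rewrite leqn0 => /eqP -> m.
move=> dj; rewrite -(divrr (factor_den_unit i.+1 j0)).
apply: eqdegM => // m md; rewrite !fseriesDE !fseriesNE !fseriesZE.
by rewrite (zdelta_eqdeg0 dj) // !mulr0.
Qed.

Lemma factor_multipliable i : multipliable (F i).
Proof. by apply: eqdeg1_multipliable => d j; apply: factor_eqdeg1. Qed.

Definition factor_trunc (D i j : nat) : fseries n.+1 R :=
  \sum_(e < D.+1)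
    ((1 - q) ^+ (0 < e)%N * q^-1 ^+ (i.+1 * e)) *: z (j * e).

Lemma factor_eqdeg_trunc D i j : (0 < j)%N ->
  eqdeg D.+1 (F i j) (factor_trunc D i j).
Proof.
move=> j0; rewrite /F factor_scale; set x := _ *: z j.
have -> : factor_trunc D i j = \sum_(e < D.+1) geom_coef q e *: x ^+ e.
  apply: eq_bigr => e _; rewrite /x exprZn -exprVn -exprM scalerA.
  by rewrite /z -zexpM; congr (_ *: zexp _); apply/mnmP=> l; rewrite !mulmnE mulnA.
apply: eqdeg_geom => //.
by rewrite /x fseriesZE (zdelta_eqdeg0 j0) ?mdeg0 // mulr0.
Qed.

(** Distributing the product over the sums picks one exponent for each pair [(i, j)], that is, one
    [mu]. The exponents of [1 - q], [q^-1] and [z] then add up to the three statistics. *)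
Lemma prod_factor_trunc D :
  \prod_(1 <= i < n.+1) \prod_(1 <= j < D.+1) factor_trunc D i j
  = \sum_(mu : mult n D) G (wall_of mu).
Proof.
rewrite big_add1 big_mkord.
under eq_bigr => i _ do rewrite big_add1 big_mkord.
rewrite pair_big /= bigA_distr_bigA /=; apply: eq_bigr => mu _.
rewrite scaler_prod big_split /= !prodrXr /G; congr (_ *: _).
  by rewrite Nstat_wall_of Mstat_wall_of exprVn.
rewrite card_wall_of /z.
rewrite (big_morph (fun j => zexp (delta n *+ j)%MM)
  (id1 := 1) (op1 := *%R)) => [//|a b|].
- rewrite -zexpD; congr zexp; apply/mnmP => l.
  by rewrite mnmDE !mulmnE mulnDr.
- by rewrite mulm0n.
Qed.

Lemma term_neq0_card Y m : G Y m != 0 -> (#|` Y|%fset <= mdeg m)%N.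
Proof.
rewrite /G fseriesZE => GY; have : z #|` Y|%fset m != 0.
  by apply: contraNneq GY => ->; rewrite mulr0.
by move=> /zdelta_neq0 ->; rewrite leq_pmull.
Qed.

Lemma term_support m :
  ([set Y | Y0 n Y /\ G Y m != 0] `<=` range (@wall_of n (mdeg m)))%classic.
Proof.
by move=> Y [Y0Y /term_neq0_card /(wall_of_surj Y0Y)[mu <-]]; exists mu.
Qed.

Lemma term_summable : summable (Y0 n) G.
Proof.
move=> m; apply: sub_finite_set (@term_support m) _.
exact/finite_image/finite_finset.
Qed.

(** Walls of [Y0] outside the range of the injective [wall_of] contribute nothing at [m]. *)
Lemma infsum_term m :
  infsum (Y0 n) G m = \sum_(mu : mult n (mdeg m)) G (wall_of mu) m.
Proof.
rewrite /infsum -(@fsbig_widen _ _ _ _ (range (@wall_of n (mdeg m)))).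
- rewrite fsbig_image; last by move=> mu mu' _ _; apply: wall_of_inj.
  rewrite [RHS]bigfs ?index_enum_uniq // => [|mu _]; last by rewrite mem_index_enum.
  by congr (\sum_(mu \in _) _); apply/seteqP.
- by move=> _ [mu _ <-]; apply: wall_of_Y0.
move=> Y [Y0Y NY]; apply/eqP; apply: contra_notT NY => GY.
by apply: term_support.
Qed.

(** At a monomial [m] the single cut-off [D = mdeg m] bounds the factors, the exponents and the
    walls that matter. *)
Lemma prod_infprod_factor :
  \prod_(1 <= i < n.+1) infprod (F i) = infsum (Y0 n) G.
Proof.
apply/funext => m; rewrite infsum_term.
rewrite -(fseries_sumE _ _ (fun mu : mult n (mdeg m) => G (wall_of mu))).
rewrite -prod_factor_trunc.
apply: (@eqdeg_prod _ _ (mdeg m).+1) => // i _ m' md.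
rewrite (@eqdeg_infprod _ _ (mdeg m).+1 (mdeg m)) //; last first.
  by move=> d j; apply: factor_eqdeg1.
move: m' md; rewrite -/(eqdeg _ _ _) big_nat [X in eqdeg _ _ X]big_nat.
by apply: eqdeg_prod => j /andP[j0 _]; apply: factor_eqdeg_trunc.
Qed.

End Expansion.

Theorem proposition4p4 (n : nat) (hn : (1 <= n)%N)
    (R : comUnitRingType) (q : R) (hq : q \is a GRing.unit) :
  let z (j : nat) : fseries n.+1 R := zexp (delta n *+ j)%MM in
  let F (i j : nat) : fseries n.+1 R :=
    (1 - q ^- i *: z j) / (1 - q ^- i.+1 *: z j) in
  let G (Y : wall) : fseries n.+1 R :=
    ((1 - q) ^+ Nstat n Y * q ^- Mstat n Y) *: z #|` Y|%fset in
  [/\ forall i : nat, (1 <= i <= n)%N -> multipliable (F i),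
      summable (Y0 n) G &
      \prod_(1 <= i < n.+1) infprod (F i) = infsum (Y0 n) G].
Proof.
move=> z F G; split; first by move=> i _; apply: factor_multipliable.
  exact: term_summable.
exact: prod_infprod_factor.
Qed.
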